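(* Let $G$ be a graph on $n$ vertices. Suppose $A\in\mathcal{S}_L(G)$ has the SSPWL. Then there is $\epsilon>0$ such that for any matrix $M\in\operatorname{Sym}_{\mathbf 1}^n(\mathbb{R})$ with $\|M-A\|<\epsilon$, there exists a matrix $A'\in\mathcal{S}_L(G)$ such that (1) $\operatorname{spec}(A')=\operatorname{spec}(M)$ and (2) $A'$ has the SSPWL.
   Context: Graphs are finite and simple. For a graph $G$ on vertex set $\{1,\ldots,n\}$, $\mathcal{S}_L(G)$ denotes the set of weighted Laplacian matrices of $G$: all $n\times n$ real symmetric matrices $A=[a_{i,j}]$ with, for $i\ne j$, $a_{i,j}<0$ if $\{i,j\}\in E(G)$ and $a_{i,j}=0$ if $\{i,j\}\notin E(G)$, and with $a_{i,i}=-\sum_{k:\{k,i\}\in E(G)}a_{i,k}$ for all $i$. $\operatorname{Sym}_{\mathbf 1}^n(\mathbb{R})$ is the space of real symmetric $n\times n$ matrices $A$ with $A\mathbf 1=\mathbf 0$, where $\mathbf 1$ is the all-ones vector. Let $J$ be the $n\times n$ all-ones matrix and $H=I-\frac1n J$. A matrix $A\in\mathcal{S}_L(G)$ has the strong spectral property for weighted Laplacian matrices (SSPWL) if $X=O$ is the only real symmetric $n\times n$ matrix satisfying $A\circ X=I\circ X=O$ and $H(AX-XA)H=O$, where $\circ$ is the entrywise product. $\operatorname{spec}$ denotes the multiset of eigenvalues; $\|\cdot\|$ is the norm induced by the inner product $\langle A,B\rangle=\operatorname{tr}(B^\top A)$. *)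

(* Defs.v *)
From mathcomp Require Import all_boot all_order all_algebra.
From mathcomp Require Import reals.

Set Implicit Arguments.
Unset Strict Implicit.
Unset Printing Implicit Defensive.

Import Order.TTheory GRing.Theory Num.Theory.

Local Open Scope ring_scope.

(* Finite simple graphs; vertex i of {1, ..., n} is the ordinal i - 1. *)
Record graph (n : nat) := Graph {
  edge :> rel 'I_n;
  edge_sym : symmetric edge;
  edge_irr : irreflexive edge
}.

Definition weighted_laplacian (R : realType) (n : nat) (G : graph n)
    (A : 'M[R]_n) : Prop :=
  [/\ A \is symmetricmx,
      forall i j, i != j -> G i j -> A i j < 0,
      forall i j, i != j -> ~~ G i j -> A i j = 0
    & forall i, A i i = - \sum_(k | G k i) A i k].

Definition sym_one (R : realType) (n : nat) (A : 'M[R]_n) : Prop :=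
  A \is symmetricmx /\ A *m const_mx 1 = 0 :> 'cV[R]_n.

Definition hadamard (R : realType) (n : nat) (A B : 'M[R]_n) : 'M[R]_n :=
  map2_mx *%R A B.

Definition centering (R : realType) (n : nat) : 'M[R]_n :=
  1%:M - n%:R^-1 *: const_mx 1.

(* The strong spectral property for weighted Laplacian matrices is only meant
   for A in S_L(G), i.e. under weighted_laplacian G A for some G; that
   membership is not included here. *)
Definition SSPWL (R : realType) (n : nat) (A : 'M[R]_n) : Prop :=
  forall X : 'M[R]_n, X \is symmetricmx ->
    hadamard A X = 0 -> hadamard 1%:M X = 0 ->
    centering R n *m (A *m X - X *m A) *m centering R n = 0 ->
    X = 0.

(* A multiset of reals is encoded by its multiplicity function: spec A x is the
   algebraic multiplicity of x as an eigenvalue of A, and 0 if x is not one.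
   Only real eigenvalues are counted, which is all of them for symmetric A. *)
Definition spec (R : realType) (n : nat) (A : 'M[R]_n) : R -> nat :=
  fun x => mup x (char_poly A).

Definition mxinner (R : realType) (n : nat) (A B : 'M[R]_n) : R :=
  \tr (B^T *m A).

(* Not the sup norm `|A| that MathComp-Analysis puts on matrices. *)
Definition mxnorm2 (R : realType) (n : nat) (A : 'M[R]_n) : R :=
  Num.sqrt (mxinner A A).

(* Main.v *)
Require Import Defs.
From mathcomp Require Import all_boot all_order all_algebra.
From mathcomp Require Import reals boolp classical_sets topology normedtype.
From mathcomp Require Import derive realfun ring lra.

Import Order.TTheory GRing.Theory Num.Theory.
Import numFieldNormedType.Exports.

Local Open Scope ring_scope.

(** The SSPWL is a transversality condition, and an inverse function theorem
    would turn it into the claim.  The proof here replaces that theorem by the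
    minimisation of a function over a compact group.

    Let [M] be close to [A].  The matrices [Q^T M Q], for [Q] orthogonal with
    [Q 1 = 1], are symmetric, kill the all-ones vector and have the spectrum of
    [M].  Write [N(X)] for the part of a matrix [X] supported on the nonedges of
    the graph; a matrix of the orbit that is close to [A] and satisfies
    [N(X) = 0] is a weighted Laplacian of the graph.  To find one, minimise
      [|N(X)| + c |X - A|]
    over the orbit ([orthogonal_orbit_min]), for a small constant [c > 0].
    The second term forces the minimiser [M'] to be close to [A]: comparison
    with [X = M] gives [c |M' - A| <= (1 + c) |M - A|].

    Suppose that [Y = N(M')] is not zero.  The matrix [K = H [M', Y] H] is skew
    and kills the all-ones vector, so the Cayley transform of [t K] yields a
    point of the orbit, equal to [M' - 2 t [M', K]] up to [O(t^2)].  Since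
    [<Y, [M', K]> = |K|^2] ([mxinner_commx]), the term [|N(X)|] drops along this
    curve at rate [2 |K|^2 / |Y|], while [c |X - A|] grows at rate at most
    [2 c |[M', K]| <= 4 c |M'| |K|].  Hence [|K| <= 2 c |M'| |Y|] at a minimiser.
    On the other hand, the SSPWL of [A] says that [Y |-> H [A, Y] H] is injective
    on the symmetric matrices supported on nonedges.  So it is bounded below on
    them, and by perturbation [|H [X, Y] H| >= kappa |Y|] for every [X] near [A]
    ([transverse_robust]).  With [2 c |M'| < kappa] this is a contradiction, so
    [N(M') = 0] ([minimiser_nonedge_part]).  The same lower bound at [X = M']
    is the SSPWL of [M']. *)

(** * The Frobenius norm *)

Lemma cauchy_schwarz_sum (R : realType) (I : finType) (a b : I -> R) :
  (\sum_i a i * b i) ^+ 2 <= (\sum_i a i ^+ 2) * (\sum_i b i ^+ 2).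
Proof.
set ab := \sum_i a i * b i; set aa := \sum_i a i ^+ 2; set bb := \sum_i b i ^+ 2.
have aa0 : 0 <= aa by apply: sumr_ge0 => i _; exact: sqr_ge0.
have expand s t : 0 <= s ^+ 2 * aa - 2 * s * t * ab + t ^+ 2 * bb.
  have -> : s ^+ 2 * aa - 2 * s * t * ab + t ^+ 2 * bb
            = \sum_i (s * a i - t * b i) ^+ 2.
    rewrite /aa /ab /bb !mulr_sumr -sumrB -big_split /=.
    by apply: eq_bigr => i _; ring.
  by apply: sumr_ge0 => i _; exact: sqr_ge0.
have [aa_pos|aa_le0] := ltrP 0 aa.
  have := expand ab aa; rewrite (_ : _ + _ = aa * (aa * bb - ab ^+ 2)); last by ring.
  by rewrite pmulr_rge0 // subr_ge0.
have aa_eq : aa = 0 by apply: le_anti; rewrite aa_le0 aa0.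
have a_eq0 i : a i = 0.
  apply/eqP; rewrite -sqrf_eq0; apply/eqP; apply: (psumr_eq0P _ aa_eq) => // k _.
  exact: sqr_ge0.
by rewrite aa_eq mul0r /ab big1 ?expr0n // => i _; rewrite a_eq0 mul0r.
Qed.

Section Frobenius.
Context {R : realType} {n : nat}.
Implicit Types A B C : 'M[R]_n.

Lemma mxinnerE A B : mxinner A B = \sum_i \sum_j A i j * B i j.
Proof.
rewrite /mxinner /mxtrace exchange_big /=; apply: eq_bigr => j _.
by rewrite mxE; apply: eq_bigr => i _; rewrite mxE mulrC.
Qed.

Lemma mxinner_ge0 A : 0 <= mxinner A A.
Proof.
by rewrite mxinnerE; do 2![apply: sumr_ge0 => ? _]; rewrite -expr2 sqr_ge0.
Qed.

Lemma sqr_mxnorm2 A : mxnorm2 A ^+ 2 = mxinner A A.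
Proof. by rewrite sqr_sqrtr ?mxinner_ge0. Qed.

Lemma mxnorm2_ge0 A : 0 <= mxnorm2 A.
Proof. exact: sqrtr_ge0. Qed.

Lemma mxinnerC A B : mxinner A B = mxinner B A.
Proof. by rewrite !mxinnerE; do 2![apply: eq_bigr => ? _]; rewrite mulrC. Qed.

Lemma mxinnerDr A B C : mxinner A (B + C) = mxinner A B + mxinner A C.
Proof. by rewrite /mxinner linearD mulmxDl mxtraceD. Qed.

Lemma mxinnerZr A (a : R) B : mxinner A (a *: B) = a * mxinner A B.
Proof. by rewrite /mxinner linearZ -scalemxAl mxtraceZ. Qed.

Lemma normr_mxinner_le A B : `|mxinner A B| <= mxnorm2 A * mxnorm2 B.
Proof.
rewrite -(@ler_pXn2r _ 2) ?nnegrE ?mulr_ge0 ?mxnorm2_ge0 //.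
rewrite real_normK ?num_real // exprMn !sqr_mxnorm2 !mxinnerE !pair_bigA /=.
exact: cauchy_schwarz_sum.
Qed.

Lemma mxnorm2D A B : mxnorm2 (A + B) <= mxnorm2 A + mxnorm2 B.
Proof.
have nA := mxnorm2_ge0 A; have nB := mxnorm2_ge0 B.
rewrite -(@ler_pXn2r _ 2) ?nnegrE ?addr_ge0 ?mxnorm2_ge0 //.
rewrite sqr_mxnorm2 mxinnerDr mxinnerC mxinnerDr [mxinner (A + B) B]mxinnerC.
rewrite mxinnerDr -!sqr_mxnorm2 [mxinner B A]mxinnerC.
have := le_trans (ler_norm _) (normr_mxinner_le A B); nra.
Qed.

Lemma mxnorm2Z (a : R) A : mxnorm2 (a *: A) = `|a| * mxnorm2 A.
Proof.
rewrite /mxnorm2 mxinnerZr mxinnerC mxinnerZr mulrA -expr2.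
by rewrite sqrtrM ?sqr_ge0 // sqrtr_sqr.
Qed.

Lemma mxnorm2N A : mxnorm2 (- A) = mxnorm2 A.
Proof. by rewrite -scaleN1r mxnorm2Z normrN1 mul1r. Qed.

Lemma mxnorm2B A B : mxnorm2 (A - B) <= mxnorm2 A + mxnorm2 B.
Proof. by rewrite (le_trans (mxnorm2D _ _)) // mxnorm2N. Qed.

Lemma mxnorm2_0 : mxnorm2 (0 : 'M[R]_n) = 0.
Proof. by rewrite -(scale0r 0) mxnorm2Z normr0 mul0r. Qed.

Lemma normr_entry_le A i j : `|A i j| <= mxnorm2 A.
Proof.
rewrite -(@ler_pXn2r _ 2) ?nnegrE ?mxnorm2_ge0 // sqr_mxnorm2 mxinnerE.
rewrite real_normK ?num_real // (bigD1 i) //= (bigD1 j) //= -addrA -expr2 lerDl.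
rewrite addr_ge0 //; first by apply: sumr_ge0 => k _; rewrite -expr2 sqr_ge0.
by do 2![apply: sumr_ge0 => ? _]; rewrite -expr2 sqr_ge0.
Qed.

Lemma mxnorm2_eq0 A : mxnorm2 A = 0 -> A = 0.
Proof.
move=> A0; apply/matrixP => i j; rewrite mxE; apply/eqP; rewrite -normr_le0.
by rewrite -A0 normr_entry_le.
Qed.

Lemma mxnorm2M A B : mxnorm2 (A *m B) <= mxnorm2 A * mxnorm2 B.
Proof.
rewrite -(@ler_pXn2r _ 2) ?nnegrE ?mulr_ge0 ?mxnorm2_ge0 //.
rewrite exprMn !sqr_mxnorm2 !mxinnerE [X in _ * X]exchange_big /=.
rewrite mulr_suml ler_sum // => i _; rewrite mulr_sumr ler_sum // => j _.
rewrite mxE -expr2; apply: le_trans (cauchy_schwarz_sum _ _ _ _) _.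
exact: lexx.
Qed.

End Frobenius.

(** * Commutators and the Cayley transform *)

Section Commutators.
Context {R : realType} {n : nat}.
Implicit Types A B K M Y : 'M[R]_n.

Definition commx A B := A *m B - B *m A.

Definition centered_commx A B := centering R n *m commx A B *m centering R n.

Lemma commxBl A B M : commx (A - B) M = commx A M - commx B M.
Proof.
by rewrite /commx mulmxBl mulmxBr !opprD !opprK addrACA.
Qed.

Lemma commxZr A (a : R) B : commx A (a *: B) = a *: commx A B.
Proof. by rewrite /commx -scalemxAr -scalemxAl scalerBr. Qed.

Lemma centered_commxZr A (a : R) B :
  centered_commx A (a *: B) = a *: centered_commx A B.
Proof. by rewrite /centered_commx commxZr -scalemxAr -scalemxAl. Qed.

Lemma centered_commxBl A B M :
  centered_commx (A - B) M = centered_commx A M - centered_commx B M.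
Proof.
by rewrite /centered_commx commxBl (mulmxBr _ (commx A M)) mulmxBl.
Qed.

Lemma mxnorm2_commx A B : mxnorm2 (commx A B) <= 2 * mxnorm2 A * mxnorm2 B.
Proof.
apply: le_trans (mxnorm2B _ _) _.
have := mxnorm2M A B; have := mxnorm2M B A; lra.
Qed.

Lemma tr_centering : (centering R n)^T = centering R n.
Proof. by rewrite /centering linearB linearZ /= trmx1 trmx_const. Qed.

Lemma centering_const m : centering R n *m const_mx 1 = 0 :> 'M_(n, m).
Proof.
rewrite /centering mulmxBl mul1mx -scalemxAl; apply/matrixP => i j; rewrite !mxE.
under eq_bigr do rewrite !mxE mulr1.
rewrite sumr_const card_ord mulVf ?subrr // pnatr_eq0 -lt0n.
exact: leq_ltn_trans (ltn_ord i).
Qed.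

Lemma centering_idem : centering R n *m centering R n = centering R n.
Proof.
by rewrite {2}/centering mulmxBr mulmx1 -scalemxAr centering_const scaler0 subr0.
Qed.

Lemma tr_centered_commx A B : A^T = A -> B^T = B ->
  (centered_commx A B)^T = - centered_commx A B.
Proof.
move=> sA sB; rewrite /centered_commx /commx !trmx_mul tr_centering.
by rewrite [(_ - _)^T]linearB /= !trmx_mul sA sB mulmxA -[A *m B - _]opprB mulmxN mulNmx opprK.
Qed.

Lemma centered_commx_const m A B :
  centered_commx A B *m const_mx 1 = 0 :> 'M_(n, m).
Proof. by rewrite /centered_commx -mulmxA centering_const mulmx0. Qed.

Lemma centered_commx_id A B :
  centering R n *m centered_commx A B *m centering R n = centered_commx A B.
Proof.
by rewrite /centered_commx !mulmxA centering_idem -!mulmxA centering_idem.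
Qed.

(** [H K H = K] for [K := centered_commx A Y], so the centering matrices can be
    moved around the commutator inside the trace. *)
Lemma mxinner_commx A Y : A^T = A -> Y^T = Y ->
  mxinner Y (commx A (centered_commx A Y)) = mxnorm2 (centered_commx A Y) ^+ 2.
Proof.
move=> sA sY; set K := centered_commx A Y.
rewrite sqr_mxnorm2 mxinnerC /mxinner sY tr_centered_commx // -/K /commx.
have tr_comm Z : \tr (Y *m (A *m Z - Z *m A)) = - \tr (commx A Y *m Z).
  rewrite mulmxBr [LHS]linearB /= /commx mulmxBl [in RHS]linearB /= opprB.
  by rewrite !mulmxA [\tr (Y *m Z *m A)]mxtrace_mulC mulmxA.
rewrite tr_comm mulNmx linearN /=; congr (- _).
rewrite -[in LHS](centered_commx_id A Y : _ = K) mulmxA mxtrace_mulC.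
by rewrite 2!mulmxA (mulmxA (centering R n) (commx A Y)).
Qed.

(** [v K v^T = 0] for skew [K], so [v (1 + K) = 0] forces [v v^T = 0]. *)
Lemma skew_unit K : K^T = - K -> 1%:M + K \in unitmx.
Proof.
move=> skewK; rewrite -row_free_unit; apply: inj_row_free => v v0.
have q0 : (v *m K *m v^T) 0 0 = 0.
  have : (v *m K *m v^T)^T 0 0 = - (v *m K *m v^T) 0 0.
    by rewrite !trmx_mul trmxK skewK mulNmx mulmxN mxE mulmxA.
  by rewrite mxE => /eqP; lra.
have : (v *m (1%:M + K) *m v^T) 0 0 = 0 by rewrite v0 mul0mx mxE.
rewrite mulmxDr mulmx1 mulmxDl [LHS]mxE q0 addr0 mxE => /eqP.
rewrite psumr_eq0 => [/allP v_eq0|i _]; last by rewrite mxE -expr2 sqr_ge0.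
apply/rowP => i; rewrite [RHS]mxE; apply/eqP.
by have := v_eq0 i (mem_index_enum i); rewrite mxE -expr2 sqrf_eq0.
Qed.

Definition cayley K := (1%:M - K) *m invmx (1%:M + K).

Section Cayley.
Context (K : 'M[R]_n) (skewK : K^T = - K).
Let P := 1%:M + K.
Let N := 1%:M - K.

Let P_unit : P \in unitmx. Proof. exact: skew_unit. Qed.
Let N_unit : N \in unitmx.
Proof. by apply: skew_unit; rewrite linearN /= skewK. Qed.
Let trP : P^T = N. Proof. by rewrite /P linearD /= trmx1 skewK. Qed.
Let trN : N^T = P. Proof. by rewrite -trP trmxK. Qed.
Let NP_comm : N *m P = P *m N.
Proof.
rewrite /N /P !(mulmxDl, mulmxDr, mulNmx, mulmxN, mulmx1, mul1mx).
by move: (K *m K) => KK; apply/matrixP => i j; rewrite !mxE; ring.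
Qed.

Lemma cayley_mulr : cayley K *m P = N.
Proof. by rewrite /cayley -mulmxA mulVmx // mulmx1. Qed.

Lemma cayley_mull : N *m (cayley K)^T = P.
Proof. by rewrite /cayley trmx_mul trmx_inv trP trN mulmxA mulmxV // mul1mx. Qed.

Lemma cayley_orth : (cayley K)^T *m cayley K = 1%:M.
Proof.
rewrite {1}/cayley trmx_mul trmx_inv trP trN /cayley !mulmxA -(mulmxA (invmx N)).
by rewrite -NP_comm mulmxA mulVmx // mul1mx mulmxV.
Qed.

Lemma cayley_fix m (B : 'M_(n, m)) : K *m B = 0 -> cayley K *m B = B.
Proof.
move=> KB; have PB : P *m B = B by rewrite mulmxDl mul1mx KB addr0.
by rewrite -{1}PB mulmxA cayley_mulr mulmxBl mul1mx KB subr0.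
Qed.

(** An exact form of the displacement, free of inverses: it is the expansion of
    [(1 - K) (D + M) (1 + K) = (1 + K) M (1 - K)]. *)
Lemma cayley_displacement M (D := (cayley K)^T *m M *m cayley K - M) :
  D = - (2 *: commx M K) - commx D K + K *m D *m K.
Proof.
have : N *m (D + M) *m P = P *m M *m N.
  rewrite subrK; move: (cayley K) cayley_mull cayley_mulr => Q NQ QP.
  transitivity ((N *m Q^T) *m M *m (Q *m P)); first by rewrite !mulmxA.
  by rewrite NQ QP.
rewrite /N /P /commx; move: D => D.
rewrite !(mulmxDl, mulmxDr, mulNmx, mulmxN, mulmx1, mul1mx).
move: (M *m K) (K *m M) (D *m K) (K *m D) (K *m M *m K) (K *m D *m K).
move=> MK KM DK KD KMK KDK /matrixP eqD; apply/matrixP => i j.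
by have := eqD i j; rewrite !mxE; lra.
Qed.

End Cayley.

Lemma orth_conj_mxnorm2 (Q M : 'M[R]_n) : Q^T *m Q = 1%:M ->
  mxnorm2 (Q^T *m M *m Q) = mxnorm2 M.
Proof.
move=> /[dup] QTQ /mulmx1C QQT; congr Num.sqrt.
rewrite /mxinner !trmx_mul trmxK !mulmxA -(mulmxA _ Q) QQT mulmx1.
by rewrite mxtrace_mulC !mulmxA QQT mul1mx.
Qed.

Lemma orth_conj_char_poly (Q M : 'M[R]_n) : Q^T *m Q = 1%:M ->
  char_poly (Q^T *m M *m Q) = char_poly M.
Proof.
move=> QTQ; rewrite /char_poly.
have -> : char_poly_mx (Q^T *m M *m Q) =
    map_mx polyC Q^T *m char_poly_mx M *m map_mx polyC Q.
  rewrite /char_poly_mx !map_mxM mulmxBr mulmxBl; congr (_ - _).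
  by rewrite mul_mx_scalar -scalemxAl -map_mxM QTQ map_mx1 scalemx1.
by rewrite !det_mulmx mulrC mulrA -det_mulmx -map_mxM (mulmx1C QTQ) map_mx1 det1 mul1r.
Qed.

(** The first-order motion of [M] under the Cayley transform of [t *: K] is
    [- 2 t [M, K]].  In [cayley_displacement] the displacement [D] is at most
    [2 |M|], so its right-hand side is [O(t)]; putting this bound back into it
    makes the two terms that contain [D] of order [t ^ 2]. *)
Lemma cayley_first_order M K : K^T = - K ->
  exists2 C : R, 0 <= C & forall t : R, 0 < t <= 1 ->
    mxnorm2 ((cayley (t *: K))^T *m M *m cayley (t *: K) - M
             + (2 * t) *: commx M K) <= C * t ^+ 2.
Proof.
move=> skewK; set m := mxnorm2 M; set k := mxnorm2 K.
have m0 : 0 <= m by exact: mxnorm2_ge0.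
have k0 : 0 <= k by exact: mxnorm2_ge0.
pose d := 8 * m * k + 2 * m * k ^+ 2.
have d0 : 0 <= d by rewrite addr_ge0 ?mulr_ge0 ?sqr_ge0.
exists (2 * k * d + k ^+ 2 * d).
  by rewrite addr_ge0 ?mulr_ge0 ?sqr_ge0.
move=> t /andP[/ltW t0 t1]; set Q := cayley _.
have skewtK : (t *: K)^T = - (t *: K) by rewrite linearZ /= skewK scalerN.
have := cayley_displacement _ skewtK M; rewrite -/Q /=.
have : mxnorm2 (Q^T *m M *m Q - M) <= 2 * m.
  apply: le_trans (mxnorm2B _ _) _; rewrite orth_conj_mxnorm2 ?cayley_orth //.
  by rewrite -/m; lra.
move: (_ - M) => D D_le; rewrite !commxZr scalerA => eqD.
have nZ (a : R) (B : 'M[R]_n) : 0 <= a -> mxnorm2 (a *: B) = a * mxnorm2 B.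
  by move=> a0; rewrite mxnorm2Z ger0_norm.
have nDK : mxnorm2 (commx D K) <= 2 * mxnorm2 D * k by exact: mxnorm2_commx.
have nMK : mxnorm2 (commx M K) <= 2 * m * k by exact: mxnorm2_commx.
have nKDK : mxnorm2 (K *m D *m K) <= k * mxnorm2 D * k.
  apply: le_trans (mxnorm2M _ _) _; rewrite ler_wpM2r //; exact: mxnorm2M.
have eqE : D + (2 * t) *: commx M K = t ^+ 2 *: (K *m D *m K) - t *: commx D K.
  rewrite {1}eqD -!scalemxAl -scalemxAr scalerA -expr2.
  by rewrite addrC !addrA subrr add0r addrC.
have nE : mxnorm2 (D + (2 * t) *: commx M K)
    <= t ^+ 2 * (k * mxnorm2 D * k) + t * (2 * mxnorm2 D * k).
  rewrite eqE; apply: le_trans (mxnorm2B _ _) _.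
  have t2 : 0 <= t ^+ 2 by exact: sqr_ge0.
  by rewrite !nZ // lerD // ler_wpM2l //.
have D0 := mxnorm2_ge0 D.
have nD : mxnorm2 D <= t * d.
  have : mxnorm2 D <= mxnorm2 (D + (2 * t) *: commx M K) + 2 * t * mxnorm2 (commx M K).
    rewrite -nZ; last by lra.
    by rewrite -{1}[D](addrK ((2 * t) *: commx M K)) mxnorm2B.
  have : t ^+ 2 * (k * mxnorm2 D * k) <= t * (2 * m * k ^+ 2).
    rewrite expr2 -mulrA ler_wpM2l //.
    have kk : 0 <= k ^+ 2 by exact: sqr_ge0.
    have : k ^+ 2 * mxnorm2 D <= k ^+ 2 * (2 * m) by rewrite ler_wpM2l.
    have : 0 <= (1 - t) * (k ^+ 2 * mxnorm2 D) by rewrite !mulr_ge0 // subr_ge0.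
    by lra.
  have : t * (2 * mxnorm2 D * k) <= t * (4 * m * k).
    by rewrite ler_wpM2l //; nra.
  have : t * mxnorm2 (commx M K) <= t * (2 * m * k) by rewrite ler_wpM2l //.
  by rewrite /d; lra.
apply: le_trans nE _.
have kD : k * mxnorm2 D <= k * (t * d) by rewrite ler_wpM2l.
have : t * (2 * mxnorm2 D * k) <= t * (2 * (t * d) * k).
  by rewrite ler_wpM2l //; lra.
have : t ^+ 2 * (k * mxnorm2 D * k) <= t ^+ 2 * (k ^+ 2 * d).
  rewrite ler_wpM2l ?sqr_ge0 //.
  have : k * (k * mxnorm2 D) <= k * (k * (t * d)) by rewrite ler_wpM2l.
  have : 0 <= (1 - t) * (k ^+ 2 * d) by rewrite !mulr_ge0 ?sqr_ge0 // subr_ge0.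
  by lra.
by lra.
Qed.

End Commutators.

(** * Minima of continuous functions of a matrix *)

Section MatrixContinuity.
Context {R : realType} {n : nat} {T : topologicalType}.
Implicit Types F E : T -> 'M[R]_n.

Definition entrywise_continuous F := forall i j, continuous (fun x => F x i j).

Lemma entrywise_continuous_cst (B : 'M[R]_n) : entrywise_continuous (fun=> B).
Proof. by move=> i j; exact: cst_continuous. Qed.

Lemma entrywise_continuousB F E : entrywise_continuous F ->
  entrywise_continuous E -> entrywise_continuous (fun x => F x - E x).
Proof.
move=> cF cE i j x.
rewrite (_ : (fun y => _) = (fun y => F y i j - E y i j)); last first.
  by apply/funext => y; rewrite !mxE.
by apply: cvgB; [exact: cF|exact: cE].
Qed.

Lemma entrywise_continuous_tr F : entrywise_continuous F ->
  entrywise_continuous (fun x => (F x)^T).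
Proof.
move=> cF i j x; rewrite (_ : (fun y => _) = (fun y => F y j i)); first exact: cF.
by apply/funext => y; rewrite mxE.
Qed.

Lemma continuous_add (f g : T -> R) : continuous f -> continuous g ->
  continuous (fun x => f x + g x).
Proof. by move=> cf cg x; apply: cvgD; [exact: cf|exact: cg]. Qed.

Lemma continuous_sum_ord m (f : 'I_m -> T -> R) : (forall i, continuous (f i)) ->
  continuous (fun x => \sum_i f i x).
Proof.
move=> cf; elim: (index_enum _) => [|i r IHr] x.
  rewrite (_ : (fun y => _) = fun=> 0); first exact: cst_continuous.
  by apply/funext => y; rewrite big_nil.
rewrite (_ : (fun y => _) = fun y => f i y + \sum_(j <- r) f j y).
  by move: x; apply: continuous_add.
by apply/funext => y; rewrite big_cons.
Qed.

Lemma entrywise_continuousM F E : entrywise_continuous F ->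
  entrywise_continuous E -> entrywise_continuous (fun x => F x *m E x).
Proof.
move=> cF cE i j.
rewrite (_ : (fun y => _) = (fun y => \sum_k F y i k * E y k j)); last first.
  by apply/funext => y; rewrite mxE.
by apply: continuous_sum_ord => k x; apply: cvgM; [exact: cF|exact: cE].
Qed.

Lemma continuous_mxnorm2 F : entrywise_continuous F ->
  continuous (fun x => mxnorm2 (F x)).
Proof.
move=> cF.
rewrite (_ : (fun y => _) =
    (fun y => Num.sqrt (\sum_i \sum_j F y i j * F y i j))); last first.
  by apply/funext => y; rewrite /mxnorm2 mxinnerE.
move=> x; apply: continuous_comp; last exact: sqrt_continuous.
by do 2![apply: continuous_sum_ord => ?] => y; apply: cvgM; exact: cF.
Qed.

End MatrixContinuity.

Section MatrixEVT.
Context {R : realType} {n : nat}.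
Implicit Types f h : 'M[R]_n -> R.

Lemma entrywise_continuous_vec_mx :
  entrywise_continuous (fun v : 'rV[R]_(n * n) => vec_mx v).
Proof.
move=> i j; rewrite (_ : (fun v => _) =
    (fun v : 'rV[R]_(n * n) => v ord0 (mxvec_index i j))).
  exact: coord_continuous.
by apply/funext => v; rewrite mxE.
Qed.

(** Matrices are read as row vectors through [vec_mx], since the compact sets used
    are the closed bounded sets of row vectors.  The constraint set is presented as
    a zero set so that its closedness is the continuity of [h]. *)
Lemma mx_EVT_min f h (b : R) :
  continuous (fun v : 'rV[R]_(n * n) => f (vec_mx v)) ->
  continuous (fun v : 'rV[R]_(n * n) => h (vec_mx v)) ->
  (forall Q, h Q = 0 -> mxnorm2 Q <= b) -> (exists Q, h Q = 0) ->
  exists2 Q, h Q = 0 & forall Q', h Q' = 0 -> f Q <= f Q'.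
Proof.
move=> cf ch hb [Q0 hQ0].
pose S := [set v : 'rV[R]_(n * n) | h (vec_mx v) = 0]%classic.
have S0 : (S !=set0)%classic by exists (mxvec Q0); rewrite /S /= mxvecK.
have b0 : 0 <= b by apply: le_trans (mxnorm2_ge0 _) (hb _ hQ0).
have clS : closed S.
  rewrite (_ : S = (fun v => h (vec_mx v)) @^-1` [set 0])%classic //.
  by apply: preimage_closed => [v _|]; [exact: ch|exact: closed_eq].
have bS : bounded_set S.
  exists b; split; first exact: num_real.
  move=> x /ltW bx v /hb vb /=; rewrite [leLHS]mx_normrE.
  apply: bigmax_le => [|[k l] _ /=]; first exact: le_trans bx.
  rewrite ord1; case/mxvec_indexP: l => i j.
  apply: le_trans bx; apply: le_trans vb.
  by have := normr_entry_le (vec_mx v) i j; rewrite mxE.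
have cfS : {within S, continuous (fun v => f (vec_mx v))}%classic.
  exact: continuous_subspaceT.
have [v vS vmin] := EVT_min_rV S0 (bounded_closed_compact bS clS) cfS.
exists (vec_mx v); first by move: vS; rewrite inE.
by move=> Q' hQ'; rewrite -[Q']mxvecK; apply: vmin; rewrite inE /S /= mxvecK.
Qed.

End MatrixEVT.

(** * Transversality at a weighted Laplacian *)

Lemma symmetricmxP (R : realType) (n : nat) (A : 'M[R]_n) :
  A \is symmetricmx <-> A^T = A.
Proof.
split=> [/is_hermitianmxP|sA].
  by rewrite expr0 scale1r map_mx_id // => <-.
by apply/is_hermitianmxP; rewrite expr0 scale1r map_mx_id.
Qed.

Lemma le0_of_small (R : realType) (x C : R) : 0 <= C ->
  (forall t : R, 0 < t <= 1 -> x <= t * C) -> x <= 0.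
Proof.
move=> C0 small; rewrite leNgt; apply/negP => x0.
have d0 : 0 < x + C + 1 by lra.
(* At this [t] the bound [t * C] is below [x], and [t <= 1]. *)
have := small (x / (x + C + 1)); rewrite divr_gt0 //= ler_pdivrMr // mulrAC.
by rewrite ler_pdivlMr //; nra.
Qed.

Section NonedgePart.
Context {R : realType} {n : nat} (G : graph n).
Implicit Types A M Y : 'M[R]_n.

Definition nonedge_part M : 'M[R]_n :=
  \matrix_(i, j) if (i == j) || G i j then 0 else M i j.

Lemma nonedge_partD M Y : nonedge_part (M + Y) = nonedge_part M + nonedge_part Y.
Proof. by apply/matrixP => i j; rewrite !mxE; case: ifP; rewrite ?addr0. Qed.

Lemma nonedge_partZ (a : R) M : nonedge_part (a *: M) = a *: nonedge_part M.
Proof. by apply/matrixP => i j; rewrite !mxE; case: ifP; rewrite ?mulr0. Qed.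

Lemma nonedge_part_id M : nonedge_part (nonedge_part M) = nonedge_part M.
Proof. by apply/matrixP => i j; rewrite !mxE; case: (_ || _). Qed.

Lemma tr_nonedge_part M : M^T = M -> (nonedge_part M)^T = nonedge_part M.
Proof.
move=> /matrixP sM; apply/matrixP => i j.
by have := sM i j; rewrite !mxE eq_sym edge_sym => ->.
Qed.

Lemma mxinner_nonedge_part M Y :
  mxinner (nonedge_part M) (nonedge_part Y) = mxinner (nonedge_part M) Y.
Proof.
rewrite !mxinnerE; do 2![apply: eq_bigr => ? _]; rewrite !mxE.
by case: ifP; rewrite ?mul0r.
Qed.

Lemma mxnorm2_nonedge_part M : mxnorm2 (nonedge_part M) <= mxnorm2 M.
Proof.
have [->|/eqP Y0] := eqVneq (mxnorm2 (nonedge_part M)) 0; first exact: mxnorm2_ge0.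
have : 0 < mxnorm2 (nonedge_part M) by rewrite lt_def mxnorm2_ge0 andbT; apply/eqP.
move/ler_pM2l => <-; rewrite -expr2 sqr_mxnorm2 mxinner_nonedge_part.
exact: le_trans (ler_norm _) (normr_mxinner_le _ _).
Qed.

Lemma weighted_laplacian_nonedge_part A :
  weighted_laplacian G A -> nonedge_part A = 0.
Proof.
case=> _ _ nonedge _; apply/matrixP => i j; rewrite !mxE.
by case: ifP => // /norP[ij nij]; exact: nonedge.
Qed.

Lemma continuous_nonedge_part {T : topologicalType} (F : T -> 'M[R]_n) :
  entrywise_continuous F -> entrywise_continuous (fun x => nonedge_part (F x)).
Proof.
move=> cF i j; rewrite (_ : (fun y => _) =
    (fun y => if (i == j) || G i j then 0 else F y i j)).
  by case: ((i == j) || G i j); [exact: cst_continuous|exact: cF].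
by apply/funext => y; rewrite mxE.
Qed.

(** For a weighted Laplacian of [G] this is the SSPWL ([SSPWL_transverse]); unlike
    it, this form refers to the zero pattern of [G] and not to that of [A], so it
    can be compared at nearby matrices of any pattern. *)
Definition transverse A :=
  forall Y, Y^T = Y -> nonedge_part Y = Y -> centered_commx A Y = 0 -> Y = 0.

Lemma SSPWL_transverse A : weighted_laplacian G A -> SSPWL A <-> transverse A.
Proof.
case=> _ edge_neg nonedge _; split=> [hS Y sY nY cY|tA X sX AX IX cX].
  apply: hS => //; first exact/symmetricmxP.
    apply/matrixP => i j; rewrite -nY !mxE.
    by case: ifP => [_|/norP[ij nij]]; rewrite ?mulr0 // nonedge ?mul0r.
  apply/matrixP => i j; rewrite -nY !mxE.
  by have [->|] := eqVneq i j; rewrite ?mulr0 ?mul0r.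
apply: tA => //; first exact/symmetricmxP.
apply/matrixP => i j; rewrite mxE; case: ifP => // /orP[/eqP <-|Gij].
  by move/matrixP: IX => /(_ i i); rewrite !mxE eqxx mul1r.
have ij : i != j by apply/eqP => ij; move: Gij; rewrite ij edge_irr.
move/matrixP: AX => /(_ i j); rewrite !mxE => /eqP.
by rewrite mulf_eq0 lt_eqF ?edge_neg //= => /eqP.
Qed.

(** [Y |-> centered_commx A Y] is linear and injective on a finite-dimensional
    space; [kappa] is its minimum norm on the unit sphere. *)
Lemma transverse_lower_bound A : transverse A ->
  exists2 kappa : R, 0 < kappa &
    forall Y, Y^T = Y -> nonedge_part Y = Y ->
      kappa * mxnorm2 Y <= mxnorm2 (centered_commx A Y).
Proof.
move=> tA.
have normalise Y : Y^T = Y -> nonedge_part Y = Y -> Y <> 0 ->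
    exists2 y : R, 0 < y & let U := y^-1 *: Y in
      [/\ mxnorm2 Y = y, U^T = U, nonedge_part U = U & mxnorm2 U = 1].
  move=> sY nY Y0; have y0 : 0 < mxnorm2 Y.
    by rewrite lt_def mxnorm2_ge0 andbT; apply/eqP => /mxnorm2_eq0.
  exists (mxnorm2 Y) => //; split=> //.
  - by rewrite linearZ /= sY.
  - by rewrite nonedge_partZ nY.
  - by rewrite mxnorm2Z ger0_norm ?invr_ge0 ?ltW // mulVf ?gt_eqF.
have [[Y0 [sY0 nY0 Y00]]|all0] :=
    pselect (exists Y, [/\ Y^T = Y, nonedge_part Y = Y & Y <> 0]); last first.
  exists 1 => // Y sY nY.
  suff -> : Y = 0 by rewrite mxnorm2_0 mulr0 mxnorm2_ge0.
  by apply: contrapT => Y0; apply: all0; exists Y.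
(* The zero set of [h] is the unit sphere of the space of admissible [Y]. *)
pose h Y := mxnorm2 (Y^T - Y) + mxnorm2 (nonedge_part Y - Y) + (mxnorm2 Y - 1) ^+ 2.
have hP Y : h Y = 0 <-> [/\ Y^T = Y, nonedge_part Y = Y & mxnorm2 Y = 1].
  rewrite /h; split=> [/eqP|[-> -> ->]]; last by rewrite !subrr mxnorm2_0 expr0n !addr0.
  rewrite !paddr_eq0 ?addr_ge0 ?mxnorm2_ge0 ?sqr_ge0 //.
  move=> /andP[/andP[/eqP/mxnorm2_eq0/eqP + /eqP/mxnorm2_eq0/eqP]].
  by rewrite sqrf_eq0 !subr_eq0 => /eqP ? /eqP ? /eqP ?.
have cV := @entrywise_continuous_vec_mx R n.
have [] := @mx_EVT_min R n (fun Y => mxnorm2 (centered_commx A Y)) h 1.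
- apply: continuous_mxnorm2; rewrite /centered_commx /commx.
  do ![exact: entrywise_continuous_cst|exact: cV|apply: entrywise_continuousM|
       apply: entrywise_continuousB|apply: entrywise_continuous_tr].
- rewrite /h; apply: continuous_add; first apply: continuous_add.
  + apply: continuous_mxnorm2; apply: entrywise_continuousB => //.
    exact: entrywise_continuous_tr.
  + apply: continuous_mxnorm2; apply: entrywise_continuousB => //.
    exact: continuous_nonedge_part.
  + have c1 : continuous (fun v : 'rV[R]_(n * n) => mxnorm2 (vec_mx v) - 1).
      have cN := continuous_mxnorm2 _ cV.
      by move=> v; exact: cvgB (cN v) (cvg_cst _).
    by move=> v; exact: cvgM (c1 v) (c1 v).
- by move=> Y /hP[_ _ ->].
- have [y _ [_ ? ? ?]] := normalise _ sY0 nY0 Y00.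
  by exists (y^-1 *: Y0); apply/hP.
move=> Y1 /hP[sY1 nY1 Y11] Y1min; exists (mxnorm2 (centered_commx A Y1)).
  rewrite lt_def mxnorm2_ge0 andbT; apply/eqP => /mxnorm2_eq0 /(tA _ sY1 nY1) Y10.
  by move: Y11; rewrite Y10 mxnorm2_0 => /eqP; rewrite eq_sym oner_eq0.
move=> Y sY nY; have [->|/eqP Yn0] := eqVneq Y 0.
  by rewrite mxnorm2_0 mulr0 mxnorm2_ge0.
have [y y0 [-> sU nU U1]] := normalise _ sY nY Yn0.
have /Y1min : h (y^-1 *: Y) = 0 by apply/hP.
rewrite centered_commxZr mxnorm2Z.
by rewrite ger0_norm ?invr_ge0 ?(ltW y0) // [y^-1 * _]mulrC ler_pdivlMr.
Qed.

(** The lower bound loses at most [2 |H|^2 |M - A|] when [A] is replaced by [M];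
    [delta] is chosen so that half of it survives. *)
Lemma transverse_robust A : transverse A ->
  exists2 kappa : R, 0 < kappa & exists2 delta : R, 0 < delta &
    forall M, mxnorm2 (M - A) <= delta -> forall Y, Y^T = Y ->
      nonedge_part Y = Y -> kappa * mxnorm2 Y <= mxnorm2 (centered_commx M Y).
Proof.
case/transverse_lower_bound => kappa kappa0 lowerA.
set H := mxnorm2 (centering R n).
have H2 : 0 <= H ^+ 2 by exact: sqr_ge0.
exists (kappa / 2); first by rewrite divr_gt0.
exists (kappa / (4 * (H ^+ 2 + 1))); first by rewrite divr_gt0 // mulr_gt0 ?ltr_wpDl.
move=> M MA Y sY nY; have Y0 := mxnorm2_ge0 Y; have MA0 := mxnorm2_ge0 (M - A).
have cMA : mxnorm2 (centered_commx (M - A) Y) <= 2 * H ^+ 2 * mxnorm2 (M - A) * mxnorm2 Y.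
  apply: le_trans (mxnorm2M _ _) _; rewrite -/H.
  have H0 : 0 <= H by exact: mxnorm2_ge0.
  have : H * mxnorm2 (centering R n *m commx (M - A) Y)
      <= H * (H * (2 * mxnorm2 (M - A) * mxnorm2 Y)).
    rewrite ler_wpM2l //; apply: le_trans (mxnorm2M _ _) _.
    by rewrite ler_wpM2l // mxnorm2_commx.
  by rewrite [_ * H]mulrC; lra.
have : mxnorm2 (centered_commx A Y) <=
    mxnorm2 (centered_commx M Y) + mxnorm2 (centered_commx (M - A) Y).
  have -> : centered_commx A Y = centered_commx M Y - centered_commx (M - A) Y.
    by rewrite centered_commxBl opprB addrC subrK.
  exact: mxnorm2B.
have := lowerA Y sY nY.
have : 2 * H ^+ 2 * mxnorm2 (M - A) * mxnorm2 Y <= kappa / 2 * mxnorm2 Y.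
  rewrite ler_wpM2r //; move: MA; rewrite ler_pdivlMr ?mulr_gt0 ?ltr_wpDl //; lra.
by lra.
Qed.

(** * The minimiser on the orbit *)

(** A nonzero nonedge part [Y] can be decreased along the Cayley curve of
    [K := centered_commx M Y], faster than the penalty [c |M - A|] increases.  The
    derivative is taken by hand: minimality at the parameter [t] gives
    [4 |K|^2 - 4 |Y| c |[M, K]| <= O(t)], and [t] tends to [0]. *)
Lemma minimiser_nonedge_part A M (c kappa : R) : M^T = M -> 0 <= c ->
  2 * c * mxnorm2 M < kappa ->
  kappa * mxnorm2 (nonedge_part M) <= mxnorm2 (centered_commx M (nonedge_part M)) ->
  (forall Q, Q^T *m Q = 1%:M -> Q *m const_mx 1 = const_mx 1 :> 'cV_n ->
    mxnorm2 (nonedge_part M) + c * mxnorm2 (M - A) <=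
    mxnorm2 (nonedge_part (Q^T *m M *m Q)) + c * mxnorm2 (Q^T *m M *m Q - A)) ->
  nonedge_part M = 0.
Proof.
move=> sM c0 ckappa; set Y := nonedge_part M; set K := centered_commx M Y.
move=> kappaK Mmin; apply: contrapT => Yn0.
have sY : Y^T = Y by exact: tr_nonedge_part.
have skewK : K^T = - K by exact: tr_centered_commx.
have [C C0 step] := cayley_first_order M K skewK.
set y := mxnorm2 Y in kappaK *; set k := mxnorm2 K in kappaK.
set m := mxnorm2 M in ckappa; set z := mxnorm2 (commx M K).
have y0 : 0 < y by rewrite lt_def mxnorm2_ge0 andbT; apply/eqP => /mxnorm2_eq0.
have y_ge0 := ltW y0.
have k0 : 0 <= k by exact: mxnorm2_ge0.
have m0 : 0 <= m by exact: mxnorm2_ge0.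
have z0 : 0 <= z by exact: mxnorm2_ge0.
have zmk : z <= 2 * m * k by exact: mxnorm2_commx.
have kappa_pos : 0 < kappa by apply: le_lt_trans ckappa; rewrite !mulr_ge0.
have kpos : 0 < k by apply: lt_le_trans kappaK; rewrite mulr_gt0.
suff : 4 * k ^+ 2 - 4 * y * c * z <= 0.
  move=> kz; have : y * c * z <= y * c * (2 * m * k) by rewrite ler_wpM2l // mulr_ge0 // ltW.
  move=> ycz; have : k * k <= k * (2 * c * m * y) by move: kz ycz; rewrite expr2; lra.
  rewrite ler_pM2l // => kle; have : 2 * c * m * y < kappa * y by rewrite ltr_pM2r.
  by move: kappaK kle; lra.
apply: (@le0_of_small _ _ (2 * y * c * C + 2 * y * C + (C + 2 * z) ^+ 2)).
  by apply: addr_ge0 (sqr_ge0 _); apply: addr_ge0; do !apply: mulr_ge0 => //.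
move=> t t01; have := step t t01; case/andP: t01 => t0 t1.
have skewtK : (t *: K)^T = - (t *: K) by rewrite linearZ /= skewK scalerN.
have := Mmin _ (cayley_orth _ skewtK).
have -> : cayley (t *: K) *m const_mx 1 = const_mx 1 :> 'cV_n.
  by apply: cayley_fix => //; rewrite -scalemxAl centered_commx_const scaler0.
move=> /(_ erefl); set M' := _ *m M *m _.
rewrite -[M'](subrK M); move: (M' - M) => D; rewrite addrK [D + M]addrC -/y => MM' DE.
set E := D + _ in DE; have D_E : D = E - (2 * t) *: commx M K by rewrite addrK.
have nD : mxnorm2 D <= C * t ^+ 2 + 2 * t * z.
  rewrite D_E; apply: le_trans (mxnorm2B _ _) _; rewrite lerD // mxnorm2Z.
  by rewrite ger0_norm // mulr_ge0 // ltW.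
have nD_t : mxnorm2 D <= t * (C + 2 * z).
  have : 0 <= C * t * (1 - t) by rewrite !mulr_ge0 ?subr_ge0 // ltW.
  by move: nD; lra.
have YD : mxinner Y D <= y * (C * t ^+ 2) - 2 * t * k ^+ 2.
  rewrite D_E -scaleNr mxinnerDr mxinnerZr mxinner_commx // -/K -/k mulNr lerD2r.
  apply: le_trans (ler_norm _) _; apply: le_trans (normr_mxinner_le _ _) _.
  by rewrite -/y ler_wpM2l // ltW.
set y' := mxnorm2 (nonedge_part (M + D)) in MM'.
have y'2 : y' ^+ 2 <= y ^+ 2 + 2 * mxinner Y D + (t * (C + 2 * z)) ^+ 2.
  rewrite sqr_mxnorm2 nonedge_partD -/Y mxinnerDr mxinnerC mxinnerDr.
  rewrite [mxinner (Y + _) _]mxinnerC mxinnerDr -!sqr_mxnorm2 -/y.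
  rewrite [mxinner _ Y]mxinnerC mxinner_nonedge_part.
  have : mxnorm2 (nonedge_part D) ^+ 2 <= (t * (C + 2 * z)) ^+ 2.
    rewrite ler_pXn2r ?nnegrE ?mxnorm2_ge0 //; last by rewrite (le_trans _ nD_t) ?mxnorm2_ge0.
    exact: le_trans (mxnorm2_nonedge_part _) nD_t.
  by lra.
have yy' : - (c * (C * t ^+ 2 + 2 * t * z)) <= y' - y.
  have : mxnorm2 (M + D - A) <= mxnorm2 (M - A) + (C * t ^+ 2 + 2 * t * z).
    by rewrite addrAC; apply: le_trans (mxnorm2D _ _) _; rewrite lerD2l.
  move/(ler_wpM2l c0); move: MM'; lra.
(* The tangent to the square at [y] compares the increments of [y] and [y ^ 2]. *)
have : 2 * y * (y' - y) <= y' ^+ 2 - y ^+ 2 by have := sqr_ge0 (y' - y); lra.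
have : 2 * y * - (c * (C * t ^+ 2 + 2 * t * z)) <= 2 * y * (y' - y).
  by rewrite ler_wpM2l // mulr_ge0 // ltW.
move: y'2 YD => ? ? ? ?; rewrite -(ler_pM2l t0); lra.
Qed.

Lemma orthogonal_orbit_min A M (c : R) :
  exists Q, [/\ Q^T *m Q = 1%:M, Q *m const_mx 1 = const_mx 1 :> 'cV_n &
    forall Q', Q'^T *m Q' = 1%:M -> Q' *m const_mx 1 = const_mx 1 :> 'cV_n ->
    mxnorm2 (nonedge_part (Q^T *m M *m Q)) + c * mxnorm2 (Q^T *m M *m Q - A) <=
    mxnorm2 (nonedge_part (Q'^T *m M *m Q')) + c * mxnorm2 (Q'^T *m M *m Q' - A)].
Proof.
(* Square form of the condition [Q 1 = 1]: [mxnorm2] is a norm on square matrices. *)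
pose J : 'M[R]_n := const_mx 1.
have JP (Q : 'M[R]_n) : Q *m J = J <-> Q *m const_mx 1 = const_mx 1 :> 'cV_n.
  split=> /matrixP QJ; apply/matrixP => i j.
    have := QJ i i; rewrite !mxE => QJi; rewrite -[RHS]QJi.
    by apply: eq_bigr => k _; rewrite !mxE.
  have := QJ i 0; rewrite !mxE => QJi; rewrite -[RHS]QJi.
  by apply: eq_bigr => k _; rewrite !mxE.
pose h (Q : 'M[R]_n) := mxnorm2 (Q^T *m Q - 1%:M) + mxnorm2 (Q *m J - J).
have hP Q : h Q = 0 <-> Q^T *m Q = 1%:M /\ Q *m const_mx 1 = const_mx 1 :> 'cV_n.
  rewrite -JP /h; split=> [/eqP|[-> ->]]; last by rewrite !subrr mxnorm2_0 addr0.
  rewrite paddr_eq0 ?mxnorm2_ge0 // => /andP[/eqP/mxnorm2_eq0/eqP + /eqP/mxnorm2_eq0/eqP].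
  by rewrite !subr_eq0 => /eqP ? /eqP ?.
have cV := @entrywise_continuous_vec_mx R n.
have cQ : entrywise_continuous
    (fun v : 'rV[R]_(n * n) => (vec_mx v)^T *m M *m vec_mx v).
  do ![exact: entrywise_continuous_cst|exact: cV|apply: entrywise_continuousM|
       apply: entrywise_continuousB|apply: entrywise_continuous_tr].
have [] := @mx_EVT_min R n (fun Q => mxnorm2 (nonedge_part (Q^T *m M *m Q))
    + c * mxnorm2 (Q^T *m M *m Q - A)) h (mxnorm2 (1%:M : 'M[R]_n)).
- apply: continuous_add.
    by apply: continuous_mxnorm2; exact: continuous_nonedge_part.
  have cN := continuous_mxnorm2 _
    (entrywise_continuousB _ _ cQ (entrywise_continuous_cst A)).
  by move=> v; exact: cvgM (cvg_cst c) (cN v).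
- rewrite /h; apply: continuous_add; apply: continuous_mxnorm2;
    do ![exact: entrywise_continuous_cst|exact: cV|apply: entrywise_continuousM|
       apply: entrywise_continuousB|apply: entrywise_continuous_tr].
- move=> Q /hP[QTQ _]; rewrite /mxnorm2 /mxinner QTQ trmx1 mul1mx //.
- by exists 1%:M; apply/hP; rewrite trmx1 !mul1mx.
move=> Q /hP[QTQ Q1] Qmin; exists Q; split=> // Q' ? ?.
by apply: Qmin; apply/hP.
Qed.

(** * Return to weighted Laplacians *)

Lemma weighted_laplacian_near A (M : 'M[R]_n) (delta : R) :
  M^T = M -> M *m const_mx 1 = 0 :> 'cV_n -> nonedge_part M = 0 ->
  (forall i j, G i j -> A i j < - delta) -> mxnorm2 (M - A) <= delta ->
  weighted_laplacian G M.
Proof.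
move=> sM M1 /matrixP nM edgeA MA.
have nonedge i j : i != j -> ~~ G i j -> M i j = 0.
  by move=> ij nij; have := nM i j; rewrite !mxE (negbTE ij) (negbTE nij).
split=> //; first exact/symmetricmxP.
  move=> i j _ /edgeA; have := le_trans (normr_entry_le (M - A) i j) MA.
  by rewrite !mxE ler_norml => /andP[_]; lra.
move=> i; move/matrixP: M1 => /(_ i 0); rewrite !mxE.
rewrite (bigD1 i) //= mxE mulr1 => /eqP; rewrite addr_eq0 => /eqP ->; congr (- _).
rewrite [RHS]big_mkcond [LHS]big_mkcond /=; apply: eq_bigr => k _.
rewrite mxE mulr1 eq_sym; have [->|ik] := eqVneq i k; first by rewrite edge_irr.
by rewrite /=; case: ifP => // /negbT nki; apply: nonedge; rewrite // edge_sym.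
Qed.

Lemma edge_margin A : weighted_laplacian G A ->
  exists2 delta : R, 0 < delta & forall i j, G i j -> A i j < - delta.
Proof.
case=> _ edge_neg _ _.
pose d := \big[Num.min/1]_(p : 'I_n * 'I_n | G p.1 p.2) (- A p.1 p.2).
have d0 : 0 < d.
  apply: lt_bigmin => // -[i j] /= Gij; rewrite oppr_gt0 edge_neg //.
  by apply/eqP => ij; move: Gij; rewrite ij edge_irr.
exists (d / 2); first by rewrite divr_gt0.
move=> i j Gij; have : d <= - A i j by exact: (bigmin_le_cond _ (j := (i, j))).
by lra.
Qed.

End NonedgePart.

Theorem lemma2p12 (R : realType) (n : nat) (G : graph n) (A : 'M[R]_n)
    (hA : weighted_laplacian G A) (hS : SSPWL A) :
  exists2 eps : R, 0 < eps &
    forall M : 'M[R]_n, sym_one M -> mxnorm2 (M - A) < eps ->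
      exists A' : 'M[R]_n,
        [/\ weighted_laplacian G A', spec A' =1 spec M & SSPWL A'].
Proof.
have [kappa kappa0 [d1 d10 lower]] :=
  transverse_robust _ _ ((SSPWL_transverse _ _ hA).1 hS).
have [d2 d20 margin] := edge_margin _ _ hA.
pose delta := Num.min d1 d2.
have delta0 : 0 < delta by rewrite lt_min d10.
have delta1 : delta <= d1 by rewrite ge_min lexx.
have delta2 : delta <= d2 by rewrite ge_min lexx orbT.
have normA := mxnorm2_ge0 A.
(* [2 * c * mxnorm2 M' <= kappa / 2] for every [M'] within [delta] of [A]. *)
pose c := kappa / (4 * (mxnorm2 A + delta)).
have c0 : 0 < c by rewrite divr_gt0 // mulr_gt0 // ltr_wpDl.
have cE : 4 * c * (mxnorm2 A + delta) = kappa.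
  by rewrite /c; field; rewrite gt_eqF // ltr_wpDl.
have c1 : 0 < 1 + c by lra.
exists (c * delta / (1 + c)); first by rewrite divr_gt0 // mulr_gt0.
move=> M [/symmetricmxP sM M1]; rewrite ltr_pdivlMr // => MA.
have [Q [QTQ Q1 Qmin]] := orthogonal_orbit_min G A M c.
set M' := Q^T *m M *m Q in Qmin.
have near : mxnorm2 (M' - A) <= delta.
  have := Qmin 1%:M; rewrite trmx1 !mul1mx !mulmx1 => /(_ erefl erefl).
  have nM : mxnorm2 (nonedge_part G M) <= mxnorm2 (M - A).
    rewrite -{1}(subrK A M) nonedge_partD (weighted_laplacian_nonedge_part _ _ hA).
    by rewrite addr0 mxnorm2_nonedge_part.
  have := mxnorm2_ge0 (nonedge_part G M') => n0 fM.
  have : c * mxnorm2 (M' - A) <= c * delta by move: MA nM n0 fM; lra.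
  by rewrite ler_pM2l.
have normM' : mxnorm2 M' <= mxnorm2 A + delta.
  by rewrite -(subrK A M') addrC (le_trans (mxnorm2D _ _)) // lerD2l.
have sM' : M'^T = M' by rewrite /M' !trmx_mul trmxK sM mulmxA.
have nM' : nonedge_part G M' = 0.
  apply: (@minimiser_nonedge_part _ _ G A M' c kappa) => //.
  - exact: ltW.
  - have := ler_wpM2l (ltW c0) normM'; move: cE kappa0; lra.
  - apply: lower; [exact: le_trans near _|exact: tr_nonedge_part|].
    exact: nonedge_part_id.
  - move=> Q' Q'TQ' Q'1.
    have -> : Q'^T *m M' *m Q' = (Q *m Q')^T *m M *m (Q *m Q').
      by rewrite trmx_mul /M' !mulmxA.
    apply: Qmin; last by rewrite -mulmxA Q'1.
    by rewrite trmx_mul mulmxA -(mulmxA _ _ Q) QTQ mulmx1.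
have lapM' : weighted_laplacian G M'.
  apply: (@weighted_laplacian_near _ _ G A M' d2) => //.
    by rewrite /M' -!mulmxA Q1 M1 mulmx0.
  exact: le_trans near delta2.
exists M'; split=> //.
  by move=> x; rewrite /spec orth_conj_char_poly.
apply/(SSPWL_transverse _ _ lapM') => Y sY nY cY; apply: mxnorm2_eq0.
have := lower M' (le_trans near delta1) Y sY nY; rewrite cY mxnorm2_0.
by rewrite pmulr_rle0 // => Yle; apply: le_anti; rewrite Yle mxnorm2_ge0.
Qed.
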